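(* Let $v,w\in V$ and $z^v\in U_{v,w}$. Then $z^w:=\varphi_w\circ\varphi_v^{-1}(z^v)\in U_w\subset\mathbb{C}^{F_w}$ is given by $$z^w_g=\prod_{f\in F_v}(z^v_f)^{(w)_f^g}\Big/\prod_{f\in F_v\setminus F_w}|z^v_f|^{(w)_f^g}$$ if $g\in F_w\cap F_v$, and $$z^w_g=\prod_{f\in F_v}(z^v_f)^{(w)_f^g}\; r_g(\mu_v(z^v))\Big/\prod_{f\in F_v\setminus F_w}|z^v_f|^{(w)_f^g}$$ if $g\in F_w\setminus F_v$.
   Context: For a finite set $B$ and a set $A$, $A^B$ is the set of functions $B\to A$; for $z\in A^B$ write $z_f=z(f)$. Let $T$ be an $n$-dimensional torus (compact, connected, commutative Lie group) with Lie algebra $\mathfrak{t}$, exponential map $\exp:\mathfrak{t}\to T$, and integral lattice $\mathfrak{t}_{\mathbb{Z}}:=\ker(\exp)$; the induced isomorphism $\mathfrak{t}/\mathfrak{t}_{\mathbb{Z}}\to T$ is also denoted $\exp$. Let $\Delta\subset\mathfrak{t}^*$ be an $n$-dimensional convex polytope, $F$ the set of its codimension one faces, $V$ the set of its vertices, and $F_v=\{f\in F\mid v\in f\}$ for $v\in V$. Assume $\Delta$ is a Delzant polytope: (i) for each $f\in F$ there are $X_f\in\mathfrak{t}$, $\lambda_f\in\mathbb{R}$ such that the hyperplane containing $f$ is $\{\xi\mid\langle X_f,\xi\rangle+\lambda_f=0\}$ and $\Delta\subset\{\xi\mid\langle X_f,\xi\rangle+\lambda_f\ge 0\}$ (with $X_f$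 normalized to be primitive in $\mathfrak{t}_{\mathbb{Z}}$, which makes $X_f,\lambda_f$ unique); (ii) for every $v\in V$ the $X_f$, $f\in F_v$, form a $\mathbb{Z}$-basis of $\mathfrak{t}_{\mathbb{Z}}$. Hence $\#F_v=n$ and $\Delta=\{\xi\in\mathfrak{t}^*\mid\langle X_f,\xi\rangle+\lambda_f\ge0\ \forall f\in F\}$. For $w\in V$ and $f\in F$, the integers $(w)_f^g$, $g\in F_w$, are the unique integers with $X_f=\sum_{g\in F_w}(w)_f^g X_g$. If $f\in F_w$ then $(w)_f^g=1$ for $g=f$ and $(w)_f^g=0$ otherwise; the convention $0^0=1$ is used in products. Let $\pi:\mathbb{R}^F\to\mathfrak{t}$, $\pi(t)=\sum_{f\in F}t_fX_f$, with induced surjection $\pi':\mathbb{R}^F/\mathbb{Z}^F\to\mathfrak{t}/\mathfrak{t}_{\mathbb{Z}}$. Put $\mathfrak{n}=\ker\pi$ and $N=\ker(\exp\circ\pi')\subset\mathbb{R}^F/\mathbb{Z}^F$ (a torus). The torus $\mathbb{R}^F/\mathbb{Z}^F$ acts on $\mathbb{C}^F$ by $(t\cdot z)_f=e^{2\pi i t_f}z_f$. Let $\mu:\mathbb{C}^F\to(\mathbb{R}^F)^*\simeq\mathbb{R}^F$, $\mu(z)_f=|z_f|^2/2$, let $\iota_{\mathfrak n}^*:(\mathbb{R}^F)^*\to\mathfrak{n}^*$ be restriction to $\mathfrak{n}$, $\lambda=(\lambda_f)_{f\in F}$, and $Z:=\{z\in\mathbb{C}^F\mid\iota_{\mathfrak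 n}^*(\mu(z))=\iota_{\mathfrak n}^*(\lambda)\}$. $N$ acts freely on the compact smooth submanifold $Z$, and $M:=Z/N$ with projection $p:Z\to M$. For $v\in V$: $\rho_v:\mathbb{C}^F\to\mathbb{C}^{F_v}$ is restriction of functions to $F_v$; $U_v$ is the interior of $\rho_v(Z)$ in $\mathbb{C}^{F_v}$; $Z_v:=\rho_v^{-1}(U_v)\cap Z$; $M_v:=Z_v/N$, an open subset of $M$; $\mu_v:\mathbb{C}^{F_v}\to\mathfrak{t}^*$ is defined by $|z_f|^2/2-\lambda_f=\langle X_f,\mu_v(z)\rangle$ for all $f\in F_v$; $\mu_v(U_v)\subset\Delta$. For $f\in F$, $r_f:\Delta\to\mathbb{R}_{\ge0}$ is $r_f(\xi)=(2(\langle X_f,\xi\rangle+\lambda_f))^{1/2}$. The map $s_v:U_v\to Z_v$ is given by $s_v(z)_f=z_f$ for $f\in F_v$ and $s_v(z)_{f'}=r_{f'}(\mu_v(z))$ for $f'\in F\setminus F_v$; $\psi_v:=p\circ s_v:U_v\to M_v$ is a diffeomorphism onto $M_v$, and $\varphi_v:=\psi_v^{-1}:M_v\to U_v$. For $v,w\in V$, $U_{v,w}:=\varphi_v(M_v\cap M_w)=\{z^v\in U_v\mid z^v_f\ne0\text{ for every }f\in F_v\setminus F_w\}$. *)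

(* Defs.v *)
From HB Require Import structures.
From mathcomp Require Import all_boot all_order all_algebra.
From mathcomp Require Import all_classical all_reals all_analysis.
From mathcomp Require Import complex.

Set Implicit Arguments.
Unset Strict Implicit.
Unset Printing Implicit Defensive.

Import Order.TTheory GRing.Theory Num.Theory.
Import numFieldNormedType.Exports.

Local Open Scope classical_set_scope.
Local Open Scope ring_scope.
Local Open Scope complex_scope.

(* [R[i]] seen as a [numFieldType]: the norm topology of MathComp-Analysis is
   attached to that structure and is not inferred on [R[i]] itself. *)
Definition Cplx (R : realType) : numFieldType := R[i].

Definition modulus (R : realType) (z : Cplx R) : R := complex.Re `|z|.

Definition ofR (R : realType) (x : R) : Cplx R := x%:C.

(* e^{2 pi i a} *)
Definition expi2pi (R : realType) (a : R) : Cplx R :=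
  cos (2 * pi * a) +i* sin (2 * pi * a).

(* MathComp has no Lie groups.  An [n]-dimensional commutative Lie group with
   its Lie algebra and exponential map is given by a Hausdorff topological
   abelian group (written additively), an [n]-dimensional real vector space, and
   a homomorphism between them that is a local homeomorphism.  A [vectType]
   carries no topology; it is given its usual one through the coordinates
   [r2v]. *)
Record torus (R : realType) (n : nat) := Torus {
  lie : vectType R ;
  grp : topologicalZmodType ;
  expT : {additive lie -> grp} ;
  lie_dim : \dim {: lie} = n ;
  grp_hausdorff : hausdorff_space grp ;
  grp_compact : compact [set: grp] ;
  grp_connected : connected [set: grp] ;
  exp_continuous : continuous (fun x : 'rV[R]_(dim lie) =>
    expT (VectorInternalTheory.r2v x)) ;
  exp_open : forall A : set 'rV[R]_(dim lie), open A ->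
    open [set expT (VectorInternalTheory.r2v x) | x in A] ;
  exp_locally_inj : \forall x \near (0 : 'rV[R]_(dim lie)),
    expT (VectorInternalTheory.r2v x) = 0 -> x = 0 }.

Section Lattice.
Variables (R : realType) (n : nat) (T : torus R n).

(* [xi Y] is the pairing of [Y : lie T] with [xi : dual]. *)
Definition dual := 'Hom(lie T, R^o).

Definition lattice : set (lie T) := [set Y | expT T Y = 0].

Definition primitive (Y : lie T) : Prop :=
  lattice Y /\
  forall (Y' : lie T) (k : int), lattice Y' -> Y = Y' *~ k -> `|k| = 1.

Definition is_Zbasis (I : finType) (b : I -> lie T) : Prop :=
  (forall i, lattice (b i)) /\
  forall Y, lattice Y -> exists! c : I -> int, Y = \sum_i b i *~ c i.

End Lattice.

Section Polytope.
Variables (R : realType) (n : nat) (T : torus R n).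
Implicit Types A G : set (dual T).

Definition convex_hull (s : seq (dual T)) : set (dual T) :=
  [set x | exists a : 'I_(size s) -> R,
     [/\ forall i, 0 <= a i, \sum_i a i = 1 & x = \sum_i a i *: s`_i]].

Definition is_polytope A : Prop := exists s, A = convex_hull s.

(* [A] is nonempty and its affine hull has dimension [k]: [U] is the smallest
   linear subspace containing all the differences [y - x]. *)
Definition has_dim A (k : nat) : Prop :=
  exists (x : dual T) (U : {vspace dual T}),
    [/\ A x, \dim U = k, forall y, A y -> y - x \in U &
        forall W : {vspace dual T},
          (forall y, A y -> y - x \in W) -> (U <= W)%VS].

(* Linear forms on [dual T] are evaluations at elements of [lie T]. *)
Definition is_face A G : Prop :=
  exists (Y : lie T) (c : R),
    (forall xi, A xi -> 0 <= xi Y + c) /\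
    G = A `&` [set xi : dual T | xi Y + c = 0].

End Polytope.

(* The finite type [F] indexes bijectively, through [facet], the set of
   codimension one faces. *)
Record delzant (R : realType) (n : nat) (T : torus R n) := Delzant {
  Delta : set (dual T) ;
  Delta_polytope : is_polytope Delta ;
  Delta_dim : has_dim Delta n ;
  F : finType ;
  facet : F -> set (dual T) ;
  facet_inj : injective facet ;
  facetP : forall G, range facet G <->
    is_face Delta G /\ exists2 k, has_dim G k & k.+1 = n ;
  X : F -> lie T ;
  lambda : F -> R ;
  X_primitive : forall f, primitive (X f) ;
  facet_hyperplane : forall f,
    facet f `<=` [set xi : dual T | xi (X f) + lambda f = 0] ;
  Delta_halfspace : forall f,
    Delta `<=` [set xi : dual T | 0 <= xi (X f) + lambda f] ;
  X_Zbasis : forall v, is_face Delta [set v] ->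
    is_Zbasis (fun f : {f : F | v \in facet f} => X (val f)) }.

Section IntegerVectors.
Variables (R : realType) (I : finType).

(* Z^I inside R^I *)
Definition intvec : {pred I -> R} :=
  fun t : I -> R => [forall i, t i \is a Num.int].

Lemma intvec_zmod_closed : zmod_closed intvec.
Proof.
split; first by apply/forallP => i; rewrite rpred0.
move=> s t /forallP hs /forallP ht; apply/forallP => i.
by rewrite rpredB.
Qed.

HB.instance Definition _ :=
  GRing.isZmodClosed.Build (I -> R) intvec intvec_zmod_closed.

(* R^I / Z^I *)
Definition RmodZ := {ideal_quot intvec}.

End IntegerVectors.

Section Quotient.
Variables (R : realType) (n : nat) (T : torus R n) (D : delzant T).

Definition vertices : set (dual T) := [set v | is_face (Delta D) [set v]].

Definition Fv (v : dual T) : finType := {f : F D | v \in facet f}.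

(* the integers (w)_f^g *)
Definition coef (w : dual T) (f : F D) : Fv w -> int :=
  xget (fun=> 0) [set c | X f = \sum_g X (val g) *~ c g].

Definition piX (t : F D -> R) : lie T := \sum_f t f *: X f.

(* [exp (piX t)] and the action below depend on [t] modulo Z^F only, so they are
   computed on the canonical representative [repr]. *)
Definition N : set (RmodZ R (F D)) := [set x | expT T (piX (repr x)) = 0].

Definition act (x : RmodZ R (F D)) (z : F D -> Cplx R) : F D -> Cplx R :=
  fun f => expi2pi (repr x f) * z f.

Definition mu (z : F D -> Cplx R) : F D -> R := fun f => modulus (z f) ^+ 2 / 2.

(* R^F is identified with its dual by the standard pairing; two elements of the
   dual have the same restriction to ker pi iff they agree on ker pi. *)
Definition Z : set (F D -> Cplx R) :=
  [set z | forall t : F D -> R, piX t = 0 ->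
     \sum_f t f * mu z f = \sum_f t f * lambda f].

(* The points of M = Z / N are the N-orbits, and [pM : Z -> M] is the quotient
   map. *)
Definition pM (z : F D -> Cplx R) : set (F D -> Cplx R) :=
  [set act x z | x in N].

Section Chart.
Variable v : dual T.

Definition rhov (z : F D -> Cplx R) : Fv v -> Cplx R := fun f => z (val f).

Definition Uv : set (Fv v -> Cplx R) :=
  interior (rhov @` Z : set {ptws Fv v -> Cplx R}).

Definition Zv : set (F D -> Cplx R) := rhov @^-1` Uv `&` Z.

Definition Mv : set (set (F D -> Cplx R)) := pM @` Zv.

(* the unique xi satisfying these equations *)
Definition muv (z : Fv v -> Cplx R) : dual T :=
  xget 0 [set xi : dual T | forall f : Fv v,
    modulus (z f) ^+ 2 / 2 - lambda (val f) = xi (X (val f))].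

(* Used on Delta only, where the radicand is nonnegative. *)
Definition rf (f : F D) (xi : dual T) : R :=
  Num.sqrt (2 * (xi (X f) + lambda f)).

Definition sv (z : Fv v -> Cplx R) : F D -> Cplx R :=
  fun f => if insub f is Some g then z g else ofR (rf f (muv z)).

Definition psiv (z : Fv v -> Cplx R) : set (F D -> Cplx R) := pM (sv z).

(* the inverse of [psiv : Uv -> Mv] *)
Definition phiv : set (F D -> Cplx R) -> (Fv v -> Cplx R) :=
  'pinv_(fun=> fun=> 0) Uv psiv.

End Chart.

(* U_{v,w} *)
Definition Uvw (v w : dual T) : set (Fv v -> Cplx R) :=
  @phiv v @` (@Mv v `&` @Mv w).

End Quotient.

Arguments coef {R n T} D w f g.
Arguments Uv {R n T} D v.
Arguments Mv {R n T} D v.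
Arguments muv {R n T} D v z.
Arguments rf {R n T} D f xi.
Arguments psiv {R n T} D v z.
Arguments phiv {R n T} D v m.
Arguments Uvw {R n T} D v w.

(* Main.v *)
From HB Require Import structures.
Require Import Defs.
From mathcomp Require Import all_boot all_order all_algebra.
From mathcomp Require Import all_classical all_reals all_analysis.
From mathcomp Require Import complex.
From mathcomp Require Import ring lra.

Set Implicit Arguments.
Unset Strict Implicit.
Unset Printing Implicit Defensive.

Import Order.TTheory GRing.Theory Num.Theory.
Import numFieldNormedType.Exports.

Local Open Scope classical_set_scope.
Local Open Scope ring_scope.

(** The facet normals X_g at a vertex w form a Z-basis of the lattice, and the
    lattice is discrete, so they are also linearly independent over R
    ([Zbasis_lin_indep]).  Hence if t in R^F represents an element of N, every
    w-coordinate sum_f (w)_f^g t_f of pi(t) is an integer ([coef_period_int]); since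
    (w)_f^g is a Kronecker symbol for f through w, the phases of t at the facets
    through w are then determined by those at the other facets ([phase_in_basis]):
      e(t_g) = prod_(f not through w) e(t_f)^(- (w)_f^g).

    The same relation lets one rotate any z in Z_v, inside its N-orbit, until
    its coordinates off F_v are nonnegative.  A point of Z is recovered up to
    phases from its restriction to F_v, because the moduli are the values of the
    moment map at the normals ([rf_muv]); so the rotated point lies in the slice
    s_v(U_v), every orbit in M_v meets that slice ([psiv_surj]), and phi_v is a
    genuine section of psi_v ([phivP]).

    Let now m lie in M_v and M_w.  Its representatives y = s_v(z^v) and
    y' = s_w(z^w) differ by some t as above: y'_f = e(t_f) y_f.  For f not
    through w the coordinate y_f does not vanish ([Zv_neq0]) and y'_f is
    nonnegative, so e(t_f) = |y_f| / y_f, which is 1 when f is not through v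
    either.  Substituting in the displayed relation gives e(t_g), and
    z^w_g = e(t_g) y_g is the asserted formula, the factors of the product over
    F_v that belong to facets through w contributing y_g if g passes through v
    and 1 otherwise ([prod_incident]). *)

(** * Phases of complex numbers *)

Section Phases.
Variable R : realType.
Implicit Types (a b : R) (z : Cplx R).

Lemma expi2pi0 : expi2pi 0 = 1 :> Cplx R.
Proof. by rewrite /expi2pi mulr0 cos0 sin0. Qed.

Lemma expi2piD a b : expi2pi (a + b) = expi2pi a * expi2pi b.
Proof.
rewrite /expi2pi mulrDr cosD sinD; apply/eqP; rewrite eq_complex /=.
by rewrite !eqxx /= addrC [cos _ * sin _]mulrC eqxx.
Qed.

Lemma expi2pi_int (k : int) : expi2pi (k%:~R : R) = 1.
Proof.
have e1 : expi2pi 1 = 1 :> Cplx R.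
  by rewrite /expi2pi mulr1 mulr_natl cos2pi sin2pi.
have en (m : nat) : expi2pi (m%:R : R) = 1.
  elim: m => [|m IHm]; first exact: expi2pi0.
  by rewrite -natr1 expi2piD IHm e1 mulr1.
case: k => m; first exact: en.
rewrite NegzE mulrNz; have := expi2piD (- m.+1%:R) m.+1%:R.
by rewrite addNr expi2pi0 en mulr1.
Qed.

Lemma norm_expi2pi a : `|expi2pi a| = 1 :> Cplx R.
Proof. by rewrite normc_def /= cos2Dsin2 sqrtr1. Qed.

Lemma expi2pi_neq0 a : expi2pi a != 0.
Proof. by rewrite -normr_eq0 norm_expi2pi oner_eq0. Qed.

Lemma expi2piN a : expi2pi (- a) = (expi2pi a)^-1.
Proof.
apply: (mulIf (expi2pi_neq0 a)).
by rewrite -expi2piD addNr expi2pi0 mulVf // expi2pi_neq0.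
Qed.

Lemma expi2piMz a (k : int) : expi2pi (k%:~R * a) = expi2pi a ^ k.
Proof.
have en (m : nat) : expi2pi (m%:R * a) = expi2pi a ^+ m.
  elim: m => [|m IHm]; first by rewrite mul0r expi2pi0 expr0.
  by rewrite -natr1 mulrDl mul1r expi2piD IHm exprSr.
case: k => m; first exact: en.
by rewrite NegzE mulrNz mulNr expi2piN en.
Qed.

Lemma expi2pi_sum (I : Type) (r : seq I) (P : pred I) (a : I -> R) :
  expi2pi (\sum_(i <- r | P i) a i) = \prod_(i <- r | P i) expi2pi (a i).
Proof. exact: (big_morph _ expi2piD expi2pi0). Qed.

Lemma normE_modulus z : `|z| = ofR (modulus z).
Proof. by rewrite /ofR /modulus normc_def. Qed.

Lemma modulus_ge0 z : 0 <= modulus z.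
Proof. by rewrite /modulus normc_def /= sqrtr_ge0. Qed.

Lemma modulus_eq z z' : `|z| = `|z'| -> modulus z = modulus z'.
Proof. by rewrite /modulus => ->. Qed.

Lemma modulus_rot a z : modulus (expi2pi a * z) = modulus z.
Proof. by apply: modulus_eq; rewrite normrM norm_expi2pi mul1r. Qed.

Lemma ofR_ge0 a : 0 <= a -> 0 <= ofR a :> Cplx R.
Proof. by rewrite /ofR ler0c. Qed.

Lemma modulus_ofR a z : 0 <= a -> modulus (ofR a * z) = a * modulus z.
Proof.
move=> a0; rewrite /modulus normrM (ger0_norm (ofR_ge0 a0)) normE_modulus.
by rewrite /ofR -rmorphM.
Qed.

Lemma cos_sin_onto (x y : R) :
  x ^+ 2 + y ^+ 2 = 1 -> exists a, cos a = x /\ sin a = y.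
Proof.
move=> xy1; have x1 : -1 <= x <= 1.
  rewrite -ler_norml -[leRHS]normr1 -ler_sqr ?nnegrE // ?normr_ge0 //.
  by rewrite !normr1 expr1n real_normK ?num_real // -xy1 lerDl sqr_ge0.
have acx : cos (acos x) = x by rewrite acosK ?in_itv.
have asx : sin (acos x) = `|y|.
  rewrite sin_acos // -xy1 addrC addKr sqrtr_sqr //.
case: (leP 0 y) => y0; first by exists (acos x); rewrite asx ger0_norm.
by exists (- acos x); rewrite cosN sinN asx ltr0_norm // opprK.
Qed.

Lemma expi2pi_polar z : exists a, expi2pi a * z = `|z|.
Proof.
have [->|z0] := eqVneq z 0; first by exists 0; rewrite mulr0 normr0.
pose u : Cplx R := `|z| / z.
have u1 : `|u| = 1 by rewrite normrM normfV normr_id divff // normr_eq0.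
have [b [bc bs]] : exists b, cos b = complex.Re u /\ sin b = complex.Im u.
  apply: cos_sin_onto; apply: (@complexI R).
  by rewrite add_Re2_Im2 u1 expr1n.
exists (b / (2 * pi)).
have -> : expi2pi (b / (2 * pi)) = u.
  rewrite /expi2pi mulrC divfK; last by rewrite mulf_neq0 ?lt0r_neq0 ?pi_gt0.
  by rewrite bc bs; case: (u).
by rewrite divfK.
Qed.

End Phases.

(** * Integral bases of the lattice of a torus *)

Section Discreteness.
Variable R : realType.

(** Dirichlet's pigeonhole argument: split the unit cube into boxes of
    side 1 / N.+1; the fractional parts of two multiples of [a] fall into the
    same box, and [q] is the difference of the two factors. *)
Lemma simultaneous_approximation (I : finType) (a : I -> R) (e : R) : 0 < e ->
  exists (q : int) (p : I -> int),
    q != 0 /\ forall i, `|q%:~R * a i - (p i)%:~R| < e.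
Proof.
move=> e0; pose N := Num.truncn e^-1.
have NV : N.+1%:R^-1 < e.
  by rewrite invf_plt ?posrE ?ltr0n // truncnS_gt.
pose fr (m : nat) i := m%:R * a i - (Num.floor (m%:R * a i))%:~R.
have fr0 m i : 0 <= fr m i by rewrite subr_ge0 ge_floor.
have fr1 m i : fr m i < 1.
  by rewrite ltrBlDr addrC -[X in _ + X]/(1%:~R) -intrD floorD1_gt.
pose box (m : nat) i := Num.truncn (N.+1%:R * fr m i).
have boxN m i : (box m i < N.+1)%N.
  rewrite -(ltr_nat R); apply: le_lt_trans (_ : N.+1%:R * fr m i < _).
    by rewrite truncn_le mulr_ge0.
  by rewrite gtr_pMr ?ltr0n.
pose h (m : 'I_#|{ffun I -> 'I_N.+1}|.+1) := [ffun i => Ordinal (boxN m i)].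
have /injectivePn[m [m' mm' hmm']] : ~~ injectiveb h.
  by apply/injectiveP => /leq_card; rewrite card_ord ltnn.
exists (m%:Z - m'%:Z),
  (fun i => Num.floor (m%:R * a i) - Num.floor (m'%:R * a i)).
split=> [|i]; first by rewrite subr_eq0.
have /(congr1 val)/= bE : h m i = h m' i by rewrite hmm'.
move: bE; rewrite !ffunE /= => bE.
have -> : (m%:Z - m'%:Z)%:~R * a i
    - (Num.floor (m%:R * a i) - Num.floor (m'%:R * a i))%:~R
    = fr m i - fr m' i.
  by rewrite /fr !intrB /=; ring.
apply: lt_trans NV; rewrite -(ltr_pM2l (_ : 0 < N.+1%:R)) ?ltr0n //.
rewrite mulfV ?pnatr_eq0 // -[X in X * _]normr_nat -normrM mulrBr.
have bnd j : (box j i)%:R <= N.+1%:R * fr j i < (box j i)%:R + 1.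
  by rewrite natr1 truncn_itv // mulr_ge0.
have := bnd m; have := bnd m'; rewrite -bE ltr_norml.
by move=> /andP[? ?] /andP[? ?]; apply/andP; split; lra.
Qed.

End Discreteness.

Section Torus.
Variables (R : realType) (n : nat) (T : torus R n).
Import VectorInternalTheory.

Lemma expT_sum_int (I : finType) (b : I -> lie T) (k : I -> int) :
  (forall i, lattice (b i)) -> lattice (\sum_i b i *~ k i).
Proof.
move=> lb; rewrite /lattice /= raddf_sum big1 // => i _.
by rewrite raddfMz /= (lb i : expT T _ = 0) mul0rz.
Qed.

(** The exponential map is locally injective at 0, so 0 is isolated among
    the lattice vectors. *)
Lemma lattice_discrete :
  exists2 e : R, 0 < e &
    forall Y : lie T, lattice Y -> `|v2r Y| < e -> Y = 0.
Proof.
have /nbhs_ballP[e e0 he] := exp_locally_inj T.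
exists e => // Y lY Ye; rewrite -[Y]v2rK (he (v2r Y)) ?linear0 ?v2rK //.
by rewrite -ball_normE /= sub0r normrN.
Qed.

(** Given a real relation sum a_i b_i = 0, integers p_i close to the q a_i
    produce a lattice vector sum p_i b_i = sum (p_i - q a_i) b_i that is as
    short as desired, hence zero.  Independence over Z gives p = 0, so each |q a_i| is
    below the error of approximation, which was chosen at most |a_i0|. *)
Lemma Zbasis_lin_indep (I : finType) (b : I -> lie T) (a : I -> R) :
  is_Zbasis b -> \sum_i a i *: b i = 0 -> forall i, a i = 0.
Proof.
move=> [lb ub] ab0 i0; apply/eqP; apply/negPn/negP => ai0.
have [e e0 he] := lattice_discrete.
pose C := 1 + \sum_i `|v2r (b i)|.
have C0 : 0 < C by rewrite ltr_wpDr ?sumr_ge0.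
(* The bound |a i0| contradicts p i0 = 0; the bound e / C makes the lattice
   vector shorter than e. *)
pose d := Num.min `|a i0| (e / C).
have d0 : 0 < d by rewrite lt_min normr_gt0 ai0 divr_gt0.
have [q [p [q0 pq]]] := simultaneous_approximation a d0.
have pE : \sum_i b i *~ p i = - \sum_i (q%:~R * a i - (p i)%:~R) *: b i.
  have E i : (q%:~R * a i - (p i)%:~R) *: b i =
      q%:~R *: (a i *: b i) - b i *~ p i.
    by rewrite scalerBl scalerA scaler_int.
  under [X in - X]eq_bigr do rewrite E.
  by rewrite sumrB -scaler_sumr ab0 scaler0 sub0r opprK.
have p0 : \sum_i b i *~ p i = 0.
  apply: he; first exact: expT_sum_int.
  rewrite pE raddfN normrN raddf_sum /=.
  apply: le_lt_trans (ler_norm_sum _ _ _) _.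
  apply: (@le_lt_trans _ _ (\sum_i d * `|v2r (b i)|)).
    apply: ler_sum => i _; rewrite linearZZ normrZ ler_wpM2r //.
    exact/ltW/pq.
  rewrite -mulr_sumr; apply: (@lt_le_trans _ _ (d * C)).
    by rewrite ltr_pM2l // /C ltrDr.
  by rewrite -ler_pdivlMr // ge_min lexx orbT.
have l0 : @lattice R n T 0 by rewrite /lattice /= raddf0.
have [c [_ cu]] := ub 0 l0.
have pi0 : p i0 = 0.
  have -> : p = (fun=> 0).
    by rewrite -(cu p) // (cu (fun=> 0)) // big1.
  by [].
have := pq i0; rewrite pi0 subr0 normrM lt_min => /andP[+ _].
rewrite gtr_pMl ?normr_gt0 // -intr_norm ltrz1 => q1.
by move: q0; rewrite -normr_gt0 gtz0_ge1 leNgt q1.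
Qed.

Lemma Zbasis_dual (I : finType) (b : I -> lie T) (a : I -> R) :
  is_Zbasis b -> exists xi : dual T, forall i, xi (b i) = a i.
Proof.
move=> hb; pose X := [tuple b (enum_val i) | i < #|I|].
have XE j : X`_(enum_rank j) = b j.
  by rewrite -tnth_nth tnth_mktuple enum_rankK.
have fX : free X.
  apply/freeP => k k0 i; rewrite -(enum_valK i).
  apply: (Zbasis_lin_indep (a := fun j => k (enum_rank j)) hb).
  rewrite -[RHS]k0 [RHS](reindex _ (onW_bij _ (@enum_rank_bij I))).
  by apply: eq_bigr => j _; rewrite XE.
exists (\sum_j a (enum_val j) *: linfun (coord X j : lie T -> R^o)) => i.
rewrite sum_lfunE (bigD1 (enum_rank i)) //= big1 => [|j ji].
  rewrite addr0 scale_lfunE lfunE /= enum_rankK.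
  by rewrite -(XE i) coord_free // eqxx /GRing.scale /= mulr1.
rewrite scale_lfunE lfunE /=.
by rewrite -(XE i) coord_free // eq_sym (negbTE ji) scaler0.
Qed.

End Torus.

(** * Facets and vertices of a Delzant polytope *)

Section Evaluation.
Variables (R : realType) (n : nat) (T : torus R n).

Definition eval_at (Y : lie T) (xi : dual T) : R^o := xi Y.

Fact eval_at_is_linear (Y : lie T) : linear (eval_at Y).
Proof. by move=> a xi xi'; rewrite /eval_at add_lfunE scale_lfunE. Qed.

HB.instance Definition _ (Y : lie T) :=
  GRing.isLinear.Build R (dual T) R^o _ (eval_at Y) (eval_at_is_linear Y).

(** Used to see that evaluation at a facet normal has a kernel of codimension
    one. *)
Lemma exists_form_neq0 (Y : lie T) : Y != 0 -> exists xi : dual T, xi Y != 0.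
Proof.
move=> Y0; apply/not_existsP => xiY; move/eqP: Y0; apply.
rewrite (coord_vbasis (memvf Y)) big1 // => i _.
have := xiY (linfun (coord (vbasis {:lie T}) i : lie T -> R^o)).
by move/negP/negPn/eqP; rewrite lfunE /= => ->; rewrite scale0r.
Qed.

End Evaluation.

Section DelzantPolytope.
Variables (R : realType) (n : nat) (T : torus R n) (D : delzant T).
Implicit Types (v w : dual T) (f : F D).

Lemma X_lattice f : lattice (X f).
Proof. by have [] := X_primitive f. Qed.

(** Zero is its own multiple by 0, so it is not primitive. *)
Lemma X_neq0 f : X f != 0.
Proof.
apply/eqP => X0; have [_ /(_ 0 0)] := X_primitive f.
rewrite X0 mulr0z normr0 => /(_ _ erefl) h.
suff /h/esym/eqP : @lattice R n T 0 by rewrite oner_eq0.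
by rewrite /lattice /= raddf0.
Qed.

Lemma vertex_Zbasis v : vertices D v ->
  is_Zbasis (fun g : Fv D v => X (val g)).
Proof. exact: X_Zbasis. Qed.

Lemma vertex_Delta v : vertices D v -> Delta D v.
Proof.
by move=> [Y [c [_ vE]]]; have : [set v] v by []; rewrite vE => -[].
Qed.

Lemma vertex_facet v (g : Fv D v) : v (X (val g)) + lambda (val g) = 0.
Proof. by apply: (@facet_hyperplane _ _ _ D); have := valP g; rewrite inE. Qed.

(** A facet is the whole intersection of [Delta D] with its hyperplane.  It
    is cut out by some affine form (Y, c), and the direction space U of its
    affine hull has dimension n - 1 and lies in the kernels of the evaluations at
    both [X f] and Y.  As [X f] is nonzero, the first kernel also has dimension n - 1 and
    equals U, so it is contained in the second. *)
Lemma mem_facet f v : Delta D v -> v (X f) + lambda f = 0 -> facet f v.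
Proof.
move=> Dv vX.
have [fP _] := facetP D (facet f).
have [|[Y [c [_ fE]]] [k [x [U [xf dU xU Umin]]] kn]] := fP.
  by exists f.
pose evL (Y' : lie T) : 'Hom(dual T, R^o) := linfun (eval_at Y').
have kE Y' xi : (xi \in lker (evL Y')) = (xi Y' == 0) by rewrite memv_ker lfunE.
have UX : (U <= lker (evL (X f)))%VS.
  apply: Umin => y yf; rewrite kE add_lfunE opp_lfunE subr_eq0 -eqr_opp.
  by rewrite (addr0_eq (facet_hyperplane yf)) (addr0_eq (facet_hyperplane xf)).
have xY : x Y + c = 0 by move: xf; rewrite fE => -[].
have UY : (U <= lker (evL Y))%VS.
  apply: Umin => y; rewrite fE => -[_ /= yY].
  rewrite kE add_lfunE opp_lfunE subr_eq0 -eqr_opp.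
  by rewrite (addr0_eq yY) (addr0_eq xY).
have dX : (\dim (lker (evL (X f))) <= k)%N.
  rewrite -ltnS kn; have dn : \dim {: dual T} = n.
    by rewrite dimvf -[RHS](lie_dim T) dimvf /dim /= muln1.
  apply: (@leq_trans (\dim {: dual T})); last by rewrite dn.
  rewrite (ltn_leqif (dimv_leqif_eq (subvf _))).
  have [xi xiX] := exists_form_neq0 (X_neq0 f).
  by apply: contra xiX => /eqP/vspaceP/(_ xi); rewrite memvf kE => ->.
have UE : U = lker (evL (X f)).
  by apply/eqP; rewrite eqEdim UX dU.
have : v - x \in lker (evL Y).
  apply: (subvP UY); rewrite UE kE add_lfunE opp_lfunE subr_eq0 -eqr_opp.
  by rewrite (addr0_eq vX) (addr0_eq (facet_hyperplane xf)).
rewrite kE add_lfunE opp_lfunE subr_eq0 => /eqP vY.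
by rewrite fE; split => //=; rewrite vY.
Qed.

Lemma X_coef v f : vertices D v ->
  X f = \sum_(g : Fv D v) X (val g) *~ coef D v f g.
Proof.
move=> hv; have [_ /(_ _ (X_lattice f))[c [cE _]]] := vertex_Zbasis hv.
by rewrite /coef; case: xgetP => [_ _ ->|/(_ c)] //.
Qed.

Lemma coef_incident v (f g : Fv D v) : vertices D v ->
  coef D v (val f) g = (f == g)%:Z.
Proof.
move=> hv; have [_ /(_ _ (X_lattice (val f)))[c [_ cu]]] := vertex_Zbasis hv.
rewrite -(cu _ (X_coef (val f) hv)) (cu (fun g => (f == g)%:Z)) //.
rewrite (bigD1 f) //= eqxx mulr1z big1 ?addr0 // => h hf.
by rewrite eq_sym (negbTE hf).
Qed.

Lemma lfun_X v f (xi : dual T) : vertices D v ->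
  xi (X f) = \sum_(g : Fv D v) (coef D v f g)%:~R * xi (X (val g)).
Proof.
move=> hv; rewrite {1}(X_coef f hv) linear_sum; apply: eq_bigr => g _.
by rewrite -scaler_int linearZ.
Qed.

Lemma piX_coef v (t : F D -> R) : vertices D v ->
  piX t = \sum_(g : Fv D v) (\sum_f (coef D v f g)%:~R * t f) *: X (val g).
Proof.
move=> hv; rewrite /piX.
under eq_bigr => f _ do rewrite {1}(X_coef f hv) scaler_sumr.
rewrite exchange_big; apply: eq_bigr => g _.
rewrite scaler_suml; apply: eq_bigr => f _.
by rewrite -scaler_int scalerA mulrC.
Qed.

(** Elements of N have integral coordinates in the basis of normals at [v],
    by independence over R. *)
Lemma coef_period_int v (t : F D -> R) (g : Fv D v) : vertices D v ->
  expT T (piX t) = 0 -> exists k : int, \sum_f (coef D v f g)%:~R * t f = k%:~R.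
Proof.
move=> hv t0; have hb := vertex_Zbasis hv.
have [k [kE _]] := hb.2 _ t0.
have /(Zbasis_lin_indep hb)/(_ g)/eqP : \sum_(g : Fv D v)
    (\sum_f (coef D v f g)%:~R * t f - (k g)%:~R) *: X (val g) = 0.
  under eq_bigr do rewrite scalerBl scaler_int.
  by rewrite sumrB -piX_coef // kE subrr.
by rewrite subr_eq0 => /eqP; exists (k g).
Qed.

Lemma mem_Fv v (g : Fv D v) : v \in facet (val g).
Proof. by case: g. Qed.

Lemma big_Fv (A : Type) (idx : A) (op : Monoid.com_law idx) v
    (P : pred (F D)) (a : F D -> A) :
  \big[op/idx]_(f | (v \in facet f) && P f) a f =
  \big[op/idx]_(g : Fv D v | P (val g)) a (val g).
Proof.
rewrite (reindex_omap (val : Fv D v -> F D) insub) /=; last first.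
  by move=> f /andP[vf _]; rewrite insubT.
by apply: eq_bigl => g; rewrite mem_Fv valK eqxx andbT.
Qed.

Lemma sum_facets v (A : nmodType) (a : F D -> A) :
  \sum_f a f =
  \sum_(g : Fv D v) a (val g) + \sum_(f | v \notin facet f) a f.
Proof.
rewrite (bigID (fun f => v \in facet f)) -(big_Fv _ v xpredT); congr (_ + _).
by apply: eq_bigl => f; rewrite andbT.
Qed.

End DelzantPolytope.

(** * The topology of pointwise convergence *)

Section PointwiseTopology.

Lemma ptws_continuous (S V : topologicalType) (I : Type)
    (h : S -> {ptws I -> V}) :
  (forall i, continuous (fun x => h x i)) -> continuous h.
Proof.
move=> hc x; apply/cvg_sup => i.
exact: (@continuous_comp_initial _ _ _ (fun f : I -> V => f i) h (hc i) x).
Qed.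

Lemma ptws_mul_continuous (I : eqType) (K : numFieldType) (c : I -> K) :
  continuous (fun u : {ptws I -> K} => (fun i => c i * u i) : {ptws I -> K}).
Proof.
apply: ptws_continuous => i u.
have pc : {for u, continuous (fun u : {ptws I -> K} => u i : K)}.
  exact: (@proj_continuous I (fun=> K : topologicalType) i u).
exact: (continuous_comp pc (@mulrl_continuous K (c i) (u i))).
Qed.

Lemma ptws_scale_continuous (I : Type) (K : numFieldType) (u : I -> K) :
  continuous (fun s : K => (fun i => s * u i) : {ptws I -> K}).
Proof. by apply: ptws_continuous => i s; exact: mulrr_continuous. Qed.

End PointwiseTopology.

(** * Orbits, slices and charts *)

Section Reduction.
Variables (R : realType) (n : nat) (T : torus R n) (D : delzant T).
Implicit Types (v w : dual T) (t s : F D -> R) (z : F D -> Cplx R).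

Definition rot t z : F D -> Cplx R := fun f => expi2pi (t f) * z f.

Lemma piXD t s : piX (t + s) = piX t + piX s.
Proof. by rewrite /piX -big_split; apply: eq_bigr => f _; rewrite scalerDl. Qed.

Lemma piXN t : piX (- t) = - piX t.
Proof. by rewrite /piX -sumrN; apply: eq_bigr => f _; rewrite scaleNr. Qed.

Lemma piX_intvec t : t \in @intvec R (F D) -> expT T (piX t) = 0.
Proof.
move=> /forallP ti; rewrite /piX.
have -> : \sum_f t f *: X f = \sum_f X f *~ Num.floor (t f).
  by apply: eq_bigr => f _; rewrite -scaler_int floorK.
by apply: expT_sum_int => f; exact: X_lattice.
Qed.

Lemma rotD t s z : rot (t + s) z = rot t (rot s z).
Proof. by apply/funext => f; rewrite /rot expi2piD mulrA. Qed.

Lemma rotNK t z : rot (- t) (rot t z) = z.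
Proof.
by apply/funext => f; rewrite /rot mulrA -expi2piD addNr expi2pi0 mul1r.
Qed.

Lemma rot_intvec t z : t \in @intvec R (F D) -> rot t z = z.
Proof.
move=> /forallP ti; apply/funext => f; rewrite /rot.
by rewrite -(floorK (ti f)) expi2pi_int mul1r.
Qed.

(** The action of N, defined through canonical representatives in R^F, is
    the action of all t in R^F with exp (piX t) = 0, since vectors of Z^F act
    trivially and are mapped to the lattice. *)
Lemma pME z :
  pM z = [set rot t z | t in [set t | expT T (piX t) = 0]].
Proof.
rewrite eqEsubset; split => _ [x xN <-]; first by exists (repr x).
have xE : repr (\pi_(RmodZ R (F D))%qT x) - x \in @intvec R (F D).
  by rewrite Quotient.idealrBE reprK.
exists (\pi_(RmodZ R (F D))%qT x).
  rewrite /N /= -[repr _](subrK x) piXD raddfD /= xN addr0.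
  exact: piX_intvec.
by rewrite -[act _ _]/(rot (repr _) z) -[repr _](subrK x) rotD rot_intvec.
Qed.

Lemma pM_refl z : pM z z.
Proof.
have i0 : 0 \in @intvec R (F D) by rewrite rpred0.
by rewrite pME; exists 0; [exact: piX_intvec|exact: rot_intvec].
Qed.

Lemma pM_rot t z : expT T (piX t) = 0 -> pM (rot t z) = pM z.
Proof.
move=> t0; rewrite !pME eqEsubset; split => _ [s s0 <-].
  by exists (s + t); rewrite ?rotD //= piXD raddfD /= t0 s0 addr0.
exists (s - t); last by rewrite rotD rotNK.
by rewrite /= piXD piXN raddfB /= t0 s0 subr0.
Qed.

Lemma mu_rot t z : mu (rot t z) = mu z.
Proof. by apply/funext => f; rewrite /mu /rot modulus_rot. Qed.

Lemma Z_rot t z : Z z -> Z (rot t z).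
Proof. by move=> zZ s s0; rewrite mu_rot; exact: zZ. Qed.

(** A point of Z has the same moment as lambda against any element of the
    kernel of pi, in particular against the relation expressing [X f] in the
    basis of normals at [v]. *)
Lemma mu_coef v z f : vertices D v -> Z z ->
  mu z f = lambda f +
    \sum_(g : Fv D v) (coef D v f g)%:~R * (mu z (val g) - lambda (val g)).
Proof.
move=> hv zZ; pose c g : R := (coef D v f g)%:~R.
(* The element e_f - sum_g c_g e_g of the kernel of pi. *)
pose t h := (h == f)%:R - \sum_(g : Fv D v) c g * (h == val g)%:R.
have sumt (V : lmodType R) (m : F D -> V) :
    \sum_h t h *: m h = m f - \sum_(g : Fv D v) c g *: m (val g).
  have delta h0 : \sum_h (h == h0)%:R *: m h = m h0.
    rewrite (bigD1 h0) //= eqxx scale1r big1 ?addr0 // => h /negbTE ->.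
    by rewrite scale0r.
  under eq_bigr do rewrite scalerBl scaler_suml.
  rewrite sumrB delta exchange_big /=; congr (_ - _); apply: eq_bigr => g _.
  by under eq_bigr do rewrite -scalerA; rewrite -scaler_sumr delta.
have t0 : piX t = 0.
  rewrite /piX sumt {1}(X_coef f hv) -sumrB big1 // => g _.
  by rewrite scaler_int subrr.
have /eqP := zZ t t0; rewrite -subr_eq0 -sumrB.
under eq_bigr do rewrite -mulrBr.
rewrite (sumt R^o (fun h => mu z h - lambda h)) subr_eq0 => /eqP.
by rewrite /GRing.scale /= => <-; rewrite addrC subrK.
Qed.

(** The equations defining [muv] have a solution because the normals at [v]
    are independent over R. *)
Lemma muvP v z (g : Fv D v) : vertices D v ->
  muv D v (rhov z) (X (val g)) = mu z (val g) - lambda (val g).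
Proof.
move=> hv; rewrite /muv; case: xgetP => [_ _ -> //|].
have [xi xiE] := Zbasis_dual
  (fun g : Fv D v => mu z (val g) - lambda (val g)) (vertex_Zbasis hv).
by move=> /(_ xi) /= []; move=> h; rewrite xiE.
Qed.

Lemma muvE v z f : vertices D v -> Z z ->
  muv D v (rhov z) (X f) + lambda f = mu z f.
Proof.
move=> hv zZ; rewrite (mu_coef f hv zZ) addrC (lfun_X _ _ hv); congr (_ + _).
by apply: eq_bigr => g _; rewrite muvP.
Qed.

(** A point of Z is determined up to phases by its restriction to F_v: the
    moduli of the other coordinates are the functions r_f of its moment. *)
Lemma rf_muv v z f : vertices D v -> Z z ->
  rf D f (muv D v (rhov z)) = modulus (z f).
Proof.
move=> hv zZ; rewrite /rf muvE // /mu mulrC divfK ?pnatr_eq0 //.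
by rewrite sqrtr_sqr ger0_norm // modulus_ge0.
Qed.

(** The rotation by t is a homeomorphism that preserves the image of Z, hence
    also the interior of that image. *)
Lemma Uv_rot v t z : Uv D v (rhov z) -> Uv D v (rhov (rot t z)).
Proof.
move=> zU.
pose h := fun u : {ptws Fv D v -> Cplx R} =>
  (fun g => expi2pi (- t (val g)) * u g) : {ptws Fv D v -> Cplx R}.
have hc : continuous h by exact: ptws_mul_continuous.
pose ZU := @rhov _ _ _ D v @` @Z R n T D.
have hK : h (rhov (rot t z)) = rhov z.
  by apply/funext => g; rewrite -[RHS](congr1 (fun z => z (val g)) (rotNK t z)).
have sub : h @^-1` ZU `<=` ZU.
  move=> u [z' z'Z z'u]; exists (rot t z'); first exact: Z_rot.
  apply/funext => g; rewrite /rhov /rot -[z' _]/(rhov z' g) z'u /h.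
  by rewrite mulrA -expi2piD addrN expi2pi0 mul1r.
have nb : nbhs (rhov (rot t z) : {ptws Fv D v -> Cplx R}) (h @^-1` ZU).
  by apply: hc; rewrite hK.
exact: (filterS sub nb).
Qed.

(** Rotate the coordinates off F_v to nonnegative reals, and compensate on
    F_v so that the rotation vector lies in the kernel of pi.  The result is on
    the slice, by [rf_muv]. *)
Lemma psiv_surj v m : vertices D v -> Mv D v m ->
  exists2 u, Uv D v u & psiv D v u = m.
Proof.
move=> hv [z [zU zZ] <-].
have [th thE] := choice (fun f => expi2pi_polar (z f)).
pose t f : R := if insub f is Some g
  then - \sum_(h | v \notin facet h) (coef D v h g)%:~R * th h else th f.
have tin (g : Fv D v) :
    t (val g) = - \sum_(h | v \notin facet h) (coef D v h g)%:~R * th h.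
  by rewrite /t valK.
have tout f : v \notin facet f -> t f = th f by move=> vf; rewrite /t insubN.
have t0 : piX t = 0.
  rewrite (piX_coef t hv) big1 // => g _; rewrite (sum_facets v).
  rewrite (bigD1 g) //= coef_incident // eqxx mul1r big1 => [|h hg].
    rewrite tin addr0; under [X in _ + X]eq_bigr => h vh do rewrite tout //.
    by rewrite addNr scale0r.
  by rewrite coef_incident // (negbTE hg) mul0r.
have z'Z : Z (rot t z) by exact: Z_rot.
exists (rhov (rot t z)); first exact: Uv_rot.
rewrite -(@pM_rot t z); last by rewrite t0 raddf0.
rewrite /psiv; congr pM; apply/funext => f; rewrite /sv.
case: insubP => [g _ <- //|vf].
by rewrite rf_muv // /rot modulus_rot tout // thE normE_modulus.
Qed.

Lemma phivP v m : vertices D v -> Mv D v m ->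
  Uv D v (phiv D v m) /\ psiv D v (phiv D v m) = m.
Proof.
move=> hv /(psiv_surj hv)[u uU um].
have mU : (psiv D v @` Uv D v) m by exists u.
split; last by rewrite /phiv pinvK ?inE.
pose B := psiv D v @` Uv D v.
by apply: (@surjpinv_image_sub _ _ _ (Uv D v) B); last by exists m.
Qed.

Lemma mu_ge0 z f : 0 <= mu z f.
Proof. by rewrite /mu divr_ge0 ?sqr_ge0. Qed.

(** On the image of Z in C^(F_w), the function |z_f|^2 / 2 is
    L + sum_g (w)_f^g |z_g|^2 / 2, where L is the value at [w] of the affine
    form defining the facet f.  If it vanishes at an interior point, it is
    nonnegative at all rescalings of that point by factors close to 1 on both
    sides; being affine in the square of the factor, it is then constant along
    them, so L = 0 and the vertex [w] lies on the facet f. *)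
Lemma Zv_neq0 w z f : vertices D w -> Zv w z -> w \notin facet f -> z f != 0.
Proof.
move=> hw [zU zZ] wf; apply/eqP => zf0; move/negP: wf; apply.
rewrite inE; apply: mem_facet; first exact: vertex_Delta.
pose c g : R := (coef D w f g)%:~R.
pose S := \sum_(g : Fv D w) c g * mu z (val g).
pose L := lambda f - \sum_(g : Fv D w) c g * lambda (val g).
have wE : w (X f) + lambda f = L.
  rewrite (lfun_X f w hw) addrC /L -sumrN; congr (_ + _).
  apply: eq_bigr => g _; rewrite -mulrN; congr (_ * _).
  by apply/eqP; rewrite -addr_eq0; apply/eqP/vertex_facet.
have muE (r : R) z' : Z z' ->
    (forall g : Fv D w, mu z' (val g) = r * mu z (val g)) ->
    mu z' f = L + r * S.
  move=> z'Z sz'; rewrite (mu_coef f hw z'Z) /L -addrA; congr (_ + _).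
  rewrite addrC /S mulr_sumr -sumrB; apply: eq_bigr => g _.
  by rewrite sz' mulrBr mulrCA.
have zLS : L + S = 0.
  rewrite -[S]mul1r -(muE 1 z zZ); last by move=> g; rewrite mul1r.
  by rewrite /mu zf0 /modulus normr0 /= expr0n mul0r.
have cs := @ptws_scale_continuous (Fv D w) (Cplx R) (rhov z) 1.
have [e e0 he] : exists2 e : R, 0 < e &
    forall x, `|x| < e -> exists2 z', Z z' &
      rhov z' = fun g : Fv D w => ofR (1 + x) * rhov z g.
  have : nbhs (1 : Cplx R) ((fun s : Cplx R => (fun i => s * rhov z i)
      : {ptws Fv D w -> Cplx R}) @^-1` (@rhov _ _ _ D w @` @Z R n T D)).
    apply: cs; rewrite (_ : (fun i => _) = rhov z) //.
    by apply/funext => g; rewrite mul1r.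
  move=> /nbhs_ballP[e /=]; rewrite ltcE /= => /andP[/eqP ei e0] he.
  exists (complex.Re e) => //.
  move=> x xe; have [] := he (ofR (1 + x)); last by move=> z' z'Z <-; exists z'.
  rewrite -ball_normE /= (_ : 1 - ofR (1 + x) = - ofR x); last first.
    by rewrite /ofR rmorphD rmorph1 opprD addNKr.
  by rewrite normrN normc_def ltcE /= ei eqxx expr0n addr0 sqrtr_sqr.
(* Below e to stay in the neighbourhood, at most 1/2 to keep 1 - d positive. *)
pose d := Num.min (e / 2) 2^-1.
have d0 : 0 < d by rewrite lt_min divr_gt0 //= invr_gt0.
have de : d < e.
  by rewrite gt_min ltr_pdivrMr // mulr_natr mulr2n ltrDl e0.
have d1 : d <= 2^-1 by rewrite ge_min lexx orbT.
have key x : `|x| = d -> 0 <= L + (1 + x) ^+ 2 * S.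
  move=> xd; have [|z' z'Z z'E] := he x; first by rewrite xd.
  rewrite -(muE _ z' z'Z) ?mu_ge0 // => g.
  rewrite /mu -[z' _]/(rhov z' g) z'E modulus_ofR.
    by rewrite exprMn mulrA.
  have : - d <= x by rewrite -xd lerNnormlW.
  by move: d1; lra.
have kp : 0 <= L + (1 + d) ^+ 2 * S by apply: key; rewrite gtr0_norm.
have km : 0 <= L + (1 - d) ^+ 2 * S by apply: key; rewrite normrN gtr0_norm.
rewrite wE; have SE : S = - L by apply/esym/addr0_eq.
rewrite SE in kp km; have d2 : 0 < 2 - d by move: d1; lra.
have kpE : L + (1 + d) ^+ 2 * - L = d * (2 + d) * - L by ring.
have kmE : L + (1 - d) ^+ 2 * - L = d * (2 - d) * L by ring.
rewrite kpE pmulr_rge0 ?mulr_gt0 ?addr_gt0 // oppr_ge0 in kp.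
rewrite kmE pmulr_rge0 ?mulr_gt0 // in km.
by apply: le_anti; rewrite kp km.
Qed.

End Reduction.

(** * Change of chart *)

Section Transition.
Variables (R : realType) (n : nat) (T : torus R n) (D : delzant T).
Implicit Types (v w : dual T) (d : F D -> R).

(** The coordinate sum_f (w)_f^g d_f is an integer, and among the facets
    through [w] only [g] contributes to it. *)
Lemma phase_in_basis w d (g : Fv D w) : vertices D w -> expT T (piX d) = 0 ->
  expi2pi (d (val g)) =
  (\prod_(f | w \notin facet f) expi2pi (d f) ^ coef D w f g)^-1.
Proof.
move=> hw d0; have [k kE] := coef_period_int g hw d0.
have := congr1 (@expi2pi R) kE.
rewrite expi2pi_int (sum_facets w) (bigD1 g) //=.
rewrite coef_incident // eqxx mul1r big1 ?addr0 => [|h hg]; last first.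
  by rewrite coef_incident // (negbTE hg) mul0r.
rewrite expi2piD expi2pi_sum; under eq_bigr do rewrite expi2piMz.
by move=> h; apply: divr1_eq; rewrite invrK.
Qed.

Lemma sv_ge0 v u f : v \notin facet f -> 0 <= @sv R n T D v u f.
Proof.
by move=> vf; rewrite /sv insubN //; apply: ofR_ge0; exact: sqrtr_ge0.
Qed.

Lemma sv_val v u (g : Fv D v) : sv u (val g) = u g.
Proof. by rewrite /sv valK. Qed.

(** For f not through [w], the phase e(d_f) rotates a nonzero number to a
    nonnegative one, so it is |sv u f| / sv u f; it is 1 if f is not through [v]
    either, where [sv u] is already nonnegative.  Then [phase_in_basis] gives the
    phase at [g]. *)
Lemma transition_phase v w d (u : Fv D v -> Cplx R) (g : Fv D w) :
  vertices D w -> expT T (piX d) = 0 ->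
  (forall f, w \notin facet f -> sv u f != 0) ->
  (forall f, w \notin facet f -> 0 <= expi2pi (d f) * sv u f) ->
  expi2pi (d (val g)) =
    (\prod_(f : Fv D v | w \notin facet (val f)) u f ^ coef D w (val f) g) /
    \prod_(f : Fv D v | w \notin facet (val f)) `|u f| ^ coef D w (val f) g.
Proof.
move=> hw d0 u0 du.
rewrite phase_in_basis // -prodf_div -prodfV.
have fE f : w \notin facet f -> expi2pi (d f) = `|sv u f| / sv u f.
  move=> wf; apply: (canRL (mulfK (u0 f wf))).
  by rewrite -[LHS]ger0_norm ?du // normrM norm_expi2pi mul1r.
rewrite (bigID (fun f => v \in facet f)) /= mulrC.
rewrite big1 ?mul1r => [|f]; last first.
  move=> /andP[wf vf]; rewrite fE // ger0_norm ?sv_ge0 // divff ?u0 //.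
  by rewrite exp1rz invr1.
under eq_bigl do rewrite andbC.
rewrite big_Fv; apply: eq_bigr => f wf.
by rewrite fE // sv_val expfzMl exprz_inv invfM !invr_expz opprK mulrC.
Qed.

(** For f through both vertices, the exponent (w)_f^g is 1 if f = g and 0
    otherwise; in the latter case the factor is 1 even where u vanishes. *)
Lemma prod_incident v w (u : Fv D v -> Cplx R) (g : Fv D w) : vertices D w ->
  \prod_(f : Fv D v) u f ^ coef D w (val f) g =
  (\prod_(f : Fv D v | w \notin facet (val f)) u f ^ coef D w (val f) g) *
  (if insub (val g) is Some h then u h else 1).
Proof.
move=> hw; rewrite (bigID (fun f => w \notin facet (val f))) /=; congr (_ * _).
under eq_bigl do rewrite negbK.
have cE (f : Fv D v) : w \in facet (val f) ->
    coef D w (val f) g = (val f == val g)%:Z.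
  move=> wf; have -> : val f = val (Sub (val f) wf : Fv D w) by rewrite SubK.
  by rewrite coef_incident.
case: insubP => [h _ hg|vg].
  rewrite (bigD1 h) /=; last by rewrite hg mem_Fv.
  rewrite cE ?hg ?eqxx ?expr1z ?mem_Fv //.
  rewrite big1 ?mulr1 // => f /andP[wf fh]; rewrite cE //.
  case: eqP => [fg|]; last by rewrite expr0z.
  by case/eqP: fh; apply: val_inj; rewrite fg; exact: esym.
rewrite big1 // => f wf; rewrite cE //.
case: eqP => [fg|]; last by rewrite expr0z.
by move: vg; rewrite -fg mem_Fv.
Qed.

End Transition.

Theorem lemma4p1 (R : realType) (n : nat) (T : torus R n) (D : delzant T)
    (v w : dual T) (hv : vertices D v) (hw : vertices D w)
    (zv : Fv D v -> Cplx R) (hzv : Uvw D v w zv) :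
  let zw := phiv D w (psiv D v zv) in
  Uv D w zw /\
  forall g : Fv D w,
    (v \in facet (val g) ->
      zw g = (\prod_(f : Fv D v) zv f ^ coef D w (val f) g) /
             \prod_(f : Fv D v | w \notin facet (val f))
               `|zv f| ^ coef D w (val f) g) /\
    (v \notin facet (val g) ->
      zw g = (\prod_(f : Fv D v) zv f ^ coef D w (val f) g) *
             ofR (rf D (val g) (muv D v zv)) /
             \prod_(f : Fv D v | w \notin facet (val f))
               `|zv f| ^ coef D w (val f) g).
Proof.
case: hzv => m [mv mw] mzv.
have [_ psiE] := phivP hv mv; rewrite mzv in psiE.
have [zwU psiwE] := phivP hw mw.
rewrite psiE /=; split=> // g.
move: zwU psiwE; set zw := phiv D w m => zwU psiwE.
have [z zZw zm] := mw.
(* Both slice points lie in the orbit of one z in Z_w, whose coordinates off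
   F_w are nonzero. *)
have [s s0 sz] : [set rot s z | s in [set s | expT T (piX s) = 0]] (sv zv).
  by rewrite -pME zm -psiE; exact: pM_refl.
have [t t0 tz] : [set rot t z | t in [set t | expT T (piX t) = 0]] (sv zw).
  by rewrite -pME zm -psiwE; exact: pM_refl.
pose d := t - s.
have d0 : expT T (piX d) = 0 by rewrite piXD piXN raddfB /= t0 s0 subr0.
have dE f : sv zw f = expi2pi (d f) * sv zv f.
  by rewrite -[_ * _]/(rot d (sv zv) f) rotD -sz rotNK tz.
have zv0 f : w \notin facet f -> sv zv f != 0.
  by move=> wf; rewrite -sz mulf_neq0 ?expi2pi_neq0 // (Zv_neq0 hw zZw).
have dz f : w \notin facet f -> 0 <= expi2pi (d f) * sv zv f.
  by move=> wf; rewrite -dE sv_ge0.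
have zwg := dE (val g); rewrite sv_val in zwg.
rewrite (transition_phase g hw d0 zv0 dz) in zwg.
have := prod_incident zv g hw; move: zwg; rewrite /sv.
case: insubP => [h vg _|vg] zwE prodE; split=> vg'.
- by rewrite zwE prodE mulrAC.
- by rewrite vg in vg'.
- by rewrite vg' in vg.
- by rewrite zwE prodE mulr1 mulrAC.
Qed.
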